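(* Let $A=A_0+A_1\zeta\in M_n(\mathcal D)$ with $A_0,A_1\in M_n(K)$. Suppose $A_0=\begin{pmatrix}A_0'&0\\0&A_0''\end{pmatrix}$ with $A_0'\in M_{n'}(K)$, $A_0''\in M_{n''}(K)$, $n'+n''=n$, and $\Lambda(A_0')\cap\Lambda(A_0'')=\emptyset$. Then there exists a matrix $B\in M_n(\mathcal D)$ such that: (i) $B$ is block diagonal, $B=\begin{pmatrix}B_0'+B_1'\zeta&0\\0&B_0''+B_1''\zeta\end{pmatrix}$, where $B_0',B_1'\in M_{n'}(K)$ and $B_0'',B_1''\in M_{n''}(K)$; (ii) $B$ is similar to $A$ over $\mathcal D$; (iii) $A_0'$ is similar to $B_0'$ over $K$, and $A_0''$ is similar to $B_0''$ over $K$.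
   Context: $K$ is an algebraically closed field of characteristic zero and $\mathcal D=K[\zeta]$ with $\zeta^2=0$ is the algebra of dual numbers over $K$. Matrices $X,Y\in M_n(\mathcal D)$ are similar over $\mathcal D$ if $Y=CXC^{-1}$ for some invertible $C\in M_n(\mathcal D)$; matrices over $K$ are similar over $K$ in the usual sense. For a matrix $X$ over $K$, $\Lambda(X)$ denotes the set of all eigenvalues of $X$. *)

(* Defs.v *)
From mathcomp Require Import all_boot all_algebra.

Set Implicit Arguments.
Unset Strict Implicit.
Unset Printing Implicit Defensive.

Import GRing.Theory.
Local Open Scope ring_scope.

Notation dual K := {poly %/ ('X^2 : {poly K})}.

(* The class of the indeterminate; [qpolyX] guards against non-monic moduli,
   but ['X^2] is unaffected: see [mk_monicX2]. *)
Definition zeta (K : fieldType) : dual K := qpolyX 'X^2.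
Arguments zeta {K}.

Lemma mk_monicX2 (K : fieldType) : mk_monic ('X^2 : {poly K}) = 'X^2.
Proof. by rewrite /mk_monic size_polyXn monicXn. Qed.

Lemma zeta_sqr (K : fieldType) : zeta ^+ 2 = 0 :> dual K.
Proof.
apply/val_inj; rewrite /zeta /qpolyX -rmorphXn /= mk_monicX2.
by rewrite Pdiv.RingMonic.rmodpp ?monicXn.
Qed.

Lemma dual_basis (K : fieldType) (x : dual K) :
  exists! ab : K * K, x = qpolyC 'X^2 ab.1 + qpolyC 'X^2 ab.2 * zeta.
Proof.
have zE : @zeta K = 'X :> {poly K}.
  rewrite /zeta /qpolyX /= mk_monicX2 Pdiv.Ring.rmodp_small //.
  by rewrite size_polyX size_polyXn.
have E a b : (qpolyC 'X^2 a + qpolyC 'X^2 b * zeta : dual K)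
           = a%:P + b *: 'X :> {poly K}.
  rewrite poly_of_qpolyD poly_of_qpolyM Pdiv.Ring.rmodp_small zE /= mul_polyC //.
  rewrite mk_monicX2 size_polyXn.
  by apply: leq_ltn_trans (size_scale_leq _ _) _; rewrite size_polyX.
exists (x`_0, x`_1); split=> [|[a b] xE] /=.
  apply/val_inj; rewrite [RHS]E /=; apply/polyP=> i.
  rewrite coefD coefC coefZ coefX; case: i => [|[|i]] /=.
  - by rewrite mulr0 addr0.
  - by rewrite mulr1 add0r.
  rewrite mulr0 addr0 nth_default //; apply: leq_trans (size_npoly x) _.
  by rewrite mk_monicX2 size_polyXn.
rewrite xE E !coefD !coefC !coefZ !coefX /=.
by rewrite mulr0 mulr1 addr0 add0r.
Qed.

Definition dual_mx (K : fieldType) (m n : nat) (X0 X1 : 'M[K]_(m, n)) :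
    'M[dual K]_(m, n) :=
  map_mx (qpolyC 'X^2) X0 + zeta *: map_mx (qpolyC 'X^2) X1.

(* [mxred.similar] relies on [pinvmx] and is only available over fields,
   whereas this notion is also used over [dual K]. *)
Definition similar_mx (R : comUnitRingType) (n : nat) (X Y : 'M[R]_n) : Prop :=
  exists2 C : 'M[R]_n, C \in unitmx & Y = C *m X *m invmx C.

(* Main.v *)
Require Import Defs.
From mathcomp Require Import all_boot all_algebra.

Set Implicit Arguments.
Unset Strict Implicit.
Unset Printing Implicit Defensive.

Import GRing.Theory.
Local Open Scope ring_scope.

(** Conjugating by [1 + zeta S] keeps the constant part [A0] and changes [A1]
    by the commutator [A0 S - S A0].  With [S] off-diagonal, killing the
    off-diagonal blocks of [A1] amounts to two Sylvester equations
    [A0' X - X A0'' = U] and [A0'' Y - Y A0' = V].  These are solvable because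
    the characteristic polynomials are coprime: if [A X = X B] then
    [0 = p(A) X = X p(B)] for [p] the characteristic polynomial of [A], and
    [p(B)] is invertible by Bezout and Cayley-Hamilton. *)

Lemma intertwine_horner_mx (R : comNzRingType) (m n : nat) (A : 'M[R]_m.+1)
    (B : 'M[R]_n.+1) (X : 'M[R]_(m.+1, n.+1)) (p : {poly R}) :
  A *m X = X *m B -> horner_mx A p *m X = X *m horner_mx B p.
Proof.
move=> AX; elim/poly_ind: p => [|p c IHp].
  by rewrite !rmorph0 mul0mx mulmx0.
rewrite !rmorphD !rmorphM /= !horner_mx_X !horner_mx_C.
by rewrite mulmxDl mulmxDr -!mulmxA AX mulmxA IHp -mulmxA scalar_mxC.
Qed.

Lemma intertwine_eq0 (F : fieldType) (m n : nat) (A : 'M[F]_m) (B : 'M[F]_n)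
    (X : 'M[F]_(m, n)) :
  coprimep (char_poly A) (char_poly B) -> A *m X = X *m B -> X = 0.
Proof.
(* [horner_mx] requires matrices of positive size, so empty ones are treated apart. *)
case: m => [|m] in A X *; first by rewrite [X]flatmx0 [RHS]flatmx0.
case: n => [|n] in B X *; first by rewrite [X]thinmx0 [RHS]thinmx0.
move=> /Bezout_eq1_coprimepP[[u v] /= uv] AX.
have pB : horner_mx B (char_poly A) *m horner_mx B u = 1%:M.
  have := congr1 (horner_mx B) uv.
  by rewrite rmorphD !rmorphM rmorph1 /= Cayley_Hamilton mulr0 addr0
    (comm_horner_mx2 B).
rewrite -[X]mulmx1 -pB mulmxA -(intertwine_horner_mx _ AX).
by rewrite Cayley_Hamilton !mul0mx.
Qed.

(** An injective endomorphism of the finite-dimensional space of [m] by [n] matrices is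
    surjective. *)
Lemma sylvester_solvable (F : fieldType) (m n : nat) (A : 'M[F]_m)
    (B : 'M[F]_n) (C : 'M[F]_(m, n)) :
  coprimep (char_poly A) (char_poly B) ->
  exists X : 'M[F]_(m, n), A *m X - X *m B = C.
Proof.
move=> copAB; pose L := lin_mulmx A - lin_mulmxr B.
have LE X : mxvec X *m L = mxvec (A *m X - X *m B).
  by rewrite mulmxBr !mul_vec_lin linearB.
have : L \in unitmx.
  (* Each row of the kernel of [L], reshaped into a matrix, intertwines [A] and [B], hence
     vanishes. *)
  rewrite -row_free_unit -kermx_eq0; apply/eqP/row_matrixP => i; rewrite row0.
  have := congr1 (row i) (mulmx_ker L).
  rewrite row_mul row0 -[row i _]vec_mxK LE => /(canRL mxvecK).
  rewrite linear0 => /subr0_eq /(intertwine_eq0 copAB) ->.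
  by rewrite linear0.
move=> Lu; exists (vec_mx (mxvec C *m invmx L)).
by apply: (can_inj mxvecK); rewrite -LE vec_mxK mulmxKV.
Qed.

(** Over an algebraically closed field, polynomials without a common root are coprime. *)
Lemma coprimep_char_poly (F : closedFieldType) (m n : nat) (A : 'M[F]_m)
    (B : 'M[F]_n) :
  [predI eigenvalue A & eigenvalue B] =i pred0 ->
  coprimep (char_poly A) (char_poly B).
Proof.
move=> disj; apply: Pdiv.ClosedField.root_coprimep => x.
rewrite -eigenvalue_root_char => Ax; apply/negP.
rewrite -/(root _ x) -eigenvalue_root_char => Bx.
by have /negP[] := negbT (disj x); apply/andP.
Qed.

Lemma dual_mx_mul (K : fieldType) (m n p : nat) (X0 X1 : 'M[K]_(m, n))
    (Y0 Y1 : 'M[K]_(n, p)) :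
  dual_mx X0 X1 *m dual_mx Y0 Y1 = dual_mx (X0 *m Y0) (X0 *m Y1 + X1 *m Y0).
Proof.
rewrite /dual_mx mulmxDl !mulmxDr -!scalemxAl -!scalemxAr.
rewrite scalerA -expr2 zeta_sqr scale0r addr0.
by rewrite !map_mxM map_mxD !map_mxM scalerDr addrA.
Qed.

Lemma dual_mx_scalar (K : fieldType) (n : nat) (a : K) :
  dual_mx (a%:M : 'M_n) 0 = (qpolyC 'X^2 a)%:M.
Proof. by rewrite /dual_mx map_scalar_mx map_mx0 scaler0 addr0. Qed.

Lemma dual_mx_block (K : fieldType) (m1 m2 n1 n2 : nat)
    (P Q : 'M[K]_(m1, n1)) (R S : 'M[K]_(m2, n2)) :
  dual_mx (block_mx P 0 0 R) (block_mx Q 0 0 S) =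
  block_mx (dual_mx P Q) 0 0 (dual_mx R S).
Proof.
rewrite /dual_mx !map_block_mx scale_block_mx add_block_mx.
by rewrite !map_mx0 !scaler0 !addr0.
Qed.

Lemma similar_mx_refl (R : comUnitRingType) (n : nat) (X : 'M[R]_n) :
  similar_mx X X.
Proof. by exists 1%:M; rewrite ?unitmx1 // invmx1 mulmx1 mul1mx. Qed.

Lemma similar_mx_intertwine (R : comUnitRingType) (n : nat) (C X Y : 'M[R]_n) :
  C \in unitmx -> Y *m C = C *m X -> similar_mx X Y.
Proof. by move=> Cu YC; exists C => //; rewrite -YC mulmxK. Qed.

Lemma similar_dual_mx (K : fieldType) (n : nat) (X0 X1 S : 'M[K]_n) :
  similar_mx (dual_mx X0 (X1 + (X0 *m S - S *m X0))) (dual_mx X0 X1).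
Proof.
(* As [zeta ^+ 2 = 0], the inverse of [1 + zeta S] is [1 - zeta S]. *)
have CV : dual_mx 1%:M S *m dual_mx 1%:M (- S) = 1%:M.
  by rewrite dual_mx_mul !mul1mx mulmx1 addNr dual_mx_scalar rmorph1.
have [Cu _] := mulmx1_unit CV.
apply: (similar_mx_intertwine Cu); rewrite (dual_mx_mul X0) (dual_mx_mul 1%:M).
congr (dual_mx _ _); first by rewrite mulmx1 mul1mx.
by rewrite mulmx1 mul1mx -addrA subrK addrC.
Qed.

Theorem theorem2p2 (K : closedFieldType) (charK : [pchar K] =i pred0)
    (n' n'' : nat) (A0' : 'M[K]_n') (A0'' : 'M[K]_n'')
    (A0 A1 : 'M[K]_(n' + n'')) (A : 'M[dual K]_(n' + n''))
    (AE : A = dual_mx A0 A1)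
    (A0E : A0 = block_mx A0' 0 0 A0'')
    (disj : [predI eigenvalue A0' & eigenvalue A0''] =i pred0) :
  exists B : 'M[dual K]_(n' + n''),
    exists (B0' B1' : 'M[K]_n') (B0'' B1'' : 'M[K]_n''),
      [/\ B = block_mx (dual_mx B0' B1') 0 0 (dual_mx B0'' B1''),
          similar_mx B A,
          similar_mx A0' B0'
        & similar_mx A0'' B0''].
Proof.
have cop := coprimep_char_poly disj.
(* The signs make the commutator cancel the off-diagonal blocks of [A1]. *)
have [X XE] := sylvester_solvable (- ursubmx A1) cop.
rewrite coprimep_sym in cop.
have [Y YE] := sylvester_solvable (- dlsubmx A1) cop.
(* The constant part is untouched, so (iii) holds by reflexivity. *)
exists (block_mx (dual_mx A0' (ulsubmx A1)) 0 0 (dual_mx A0'' (drsubmx A1))).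
exists A0', (ulsubmx A1), A0'', (drsubmx A1).
split=> //; [| exact: similar_mx_refl..].
(* For this off-diagonal [S], the diagonal blocks of [A0 S - S A0] vanish and the others are the two
   Sylvester expressions. *)
have := similar_dual_mx A0 A1 (block_mx 0 X Y 0).
rewrite -AE A0E -{1}[A1]submxK !mulmx_block opp_block_mx !add_block_mx.
rewrite !(mul0mx, mulmx0, addr0, add0r, subr0) XE YE !subrr.
by rewrite dual_mx_block.
Qed.
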